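(* For any number of agents $k\ge 2$, every online exploration strategy for tadpole graphs has competitive ratio at least $1.5$ in the time model.
   Context: Multi-agent online graph exploration: an undirected connected graph $G=(V,E)$ with positive edge lengths $l(e)$ and distinctly labelled nodes is initially unknown. $k$ agents start at a node $s$; initially they know $s$, its incident edges (with lengths) and its neighbours. Whenever an agent visits a node $v$ for the first time, all edges incident to $v$ (with lengths) and the neighbours of $v$ are revealed. Agents share all information instantly, have unlimited computation, move at unit speed (traversing $e$ takes time $l(e)$), and may wait. The exploration is finished when every node has been visited and all agents are back at $s$. Time model: cost is the finishing time. $opt(G,s,k)$ is the minimum cost of an exploration by $k$ agents with full prior knowledge of $G$; an online strategy has competitive ratio $c$ on a class if $c$ is the supremum of its cost divided by $opt(G,s,k)$ over all $G$ in the class and $s\in V$. A tadpole graph consists of a cycle together with a path (the tail, at least one edge) attached to one cycle node (the intersection, of degree 3); the other end of the tail has degree 1. *)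

(* Defs.v *)
From HB Require Import structures.
From mathcomp Require Import all_boot all_order all_algebra.
From mathcomp Require Import finmap.
From mathcomp Require Import all_classical all_reals all_analysis.

Set Implicit Arguments.
Unset Strict Implicit.
Unset Printing Implicit Defensive.

Import Order.TTheory GRing.Theory Num.Theory.
Local Open Scope ring_scope.
Local Open Scope classical_set_scope.

(* Nodes are identified with their (distinct) natural-number labels; [len] is
   meaningful on edges only. *)
Record graph (R : realType) := Graph {
  nodes : {fset nat};
  edge : rel nat;
  len : nat -> nat -> R;
  edge_nodes : forall u v, edge u v -> u \in nodes;
  edge_sym : symmetric edge;
  edge_irr : irreflexive edge;
  len_sym : forall u v, edge u v -> len u v = len v u;
  len_gt0 : forall u v, edge u v -> 0 < len u v;
  graph_connected : forall u v, u \in nodes -> v \in nodes ->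
    exists p, path edge u p /\ last u p = v
}.

Definition cycle_succ (c : seq nat) : rel nat :=
  fun u v => (u \in c) && (v == next c u).

Definition path_succ (p : seq nat) : rel nat :=
  fun u v => (u, v) \in zip p (behead p).

(* [x] is the intersection, [x :: c] the cycle, [x :: t] the tail. *)
Definition tadpole (R : realType) : set (graph R) :=
  [set G | exists x c t,
    [/\ (2 <= size c)%N,
        (1 <= size t)%N,
        uniq (x :: c ++ t),
        nodes G =i x :: c ++ t &
        forall u v, edge G u v =
          [|| cycle_succ (x :: c) u v, cycle_succ (x :: c) v u,
              path_succ (x :: t) u v | path_succ (x :: t) v u]]].

(* A move [(d, y)] leaves the current node at time [d] along the edge to [y],
   reaching [y] after exactly the length of that edge.  Agents wait at nodes,
   and a traversal, once begun, is carried through: turning back inside an edge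
   is not possible. *)
Definition itinerary (R : realType) := seq (R * nat).

Fixpoint feasible (R : realType) (G : graph R) (r : R) (x : nat)
    (p : itinerary R) : bool :=
  if p is (d, y) :: q
  then [&& r <= d, edge G x y & feasible G (d + len G x y) y q]
  else true.

Fixpoint arrivals (R : realType) (G : graph R) (x : nat) (p : itinerary R) :
    seq (R * nat) :=
  if p is (d, y) :: q then (d + len G x y, y) :: arrivals G y q else [::].

(* At its departure and arrival instants an agent is at the node; strictly in
   between it is at no node. *)
Fixpoint at_node (R : realType) (G : graph R) (x : nat) (p : itinerary R)
    (t : R) (v : nat) : bool :=
  if p is (d, y) :: q
  then if t <= d then v == x else (d + len G x y <= t) && at_node G y q t v
  else v == x.

Definition schedule (R : realType) (k : nat) := 'I_k -> itinerary R.

Definition valid (R : realType) (k : nat) (G : graph R) (s : nat)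
    (S : schedule R k) : Prop :=
  forall i, feasible G 0 s (S i).

Definition visited (R : realType) (k : nat) (G : graph R) (s : nat)
    (S : schedule R k) (t : R) : set nat :=
  [set v | v = s \/ exists i a, (a, v) \in arrivals G s (S i) /\ a <= t].

Definition finished (R : realType) (k : nat) (G : graph R) (s : nat)
    (S : schedule R k) (t : R) : Prop :=
  [/\ 0 <= t,
      forall v, v \in nodes G -> visited G s S t v &
      forall i, at_node G s (S i) t s].

Definition exploration (R : realType) (k : nat) (G : graph R) (s : nat) :
    set (schedule R k) :=
  [set S | valid G s S /\ exists t, finished G s S t].

(* Itineraries are finite and agents are at nodes during closed time intervals,
   so the first finishing time of an exploration is attained. *)
Definition cost (R : realType) (k : nat) (G : graph R) (s : nat)
    (S : schedule R k) : R :=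
  inf [set t | finished G s S t].

(* Positive for [k > 0] as soon as there are two nodes. *)
Definition opt (R : realType) (G : graph R) (s : nat) (k : nat) : R :=
  inf [set cost G s S | S in @exploration R k G s].

(* What the agents know at time [t]: the visited nodes, and the edges incident
   to them (as triples: visited node, neighbour, length). *)
Definition knowledge (R : realType) (k : nat) (G : graph R) (s : nat)
    (S : schedule R k) (t : R) : set nat * set (nat * nat * R) :=
  (visited G s S t,
   [set e | [/\ visited G s S t e.1.1, edge G e.1.1 e.1.2 &
                e.2 = len G e.1.1 e.1.2]]).

Definition strategy (R : realType) (k : nat) :=
  graph R -> nat -> schedule R k.

(* A deterministic strategy is presented by the schedule that it produces on
   each input.  It is online when the moves begun up to time [t] depend only on
   the start node and on the history of the knowledge up to time [t]; since
   lengths are positive, the latter depends only on moves begun before [t]. *)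
Definition nonanticipating (R : realType) (k : nat) (C : set (graph R))
    (A : strategy R k) : Prop :=
  forall (G H : graph R) (s : nat) (t : R),
    C G -> C H -> s \in nodes G -> s \in nodes H ->
    (forall t', t' <= t ->
       knowledge G s (A G s) t' = knowledge H s (A H s) t') ->
    forall i, [seq m <- A G s i | m.1 <= t] = [seq m <- A H s i | m.1 <= t].

Definition online_exploration_strategy (R : realType) (k : nat)
    (C : set (graph R)) (A : strategy R k) : Prop :=
  (forall G s, C G -> s \in nodes G -> exploration G s (A G s)) /\
  nonanticipating C A.

Definition competitive_ratio (R : realType) (k : nat) (C : set (graph R))
    (A : strategy R k) : \bar R :=
  ereal_sup [set r | exists G s,
    [/\ C G, s \in nodes G & r = (cost G s (A G s) / opt G s k)%:E]].

(* Main.v *)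
(* Let node 1 be the start, with one incident edge of length 1 leading to node 0
   and, on the other side, a path 1, 2, 3, ... of edges of length e = 1 / N.+1.
   First run the strategy on the tadpole in which 0 is the end of the tail and
   the path ends in a triangle beyond distance 1.  Two agents need only
   2 (1 + 2 e) there, so if every departure towards 0 happens at time 1 or
   later, the cost is at least 3 and the ratio is close to 3 / 2.
   Otherwise some agent departs at a time T < 1.  By then only nodes at distance
   less than (m + 1) e are known, with m e <= T < (m + 1) e, so the strategy
   behaves identically up to T on the tadpole in which the path turns back to 0
   right after node m.+2.  Here 0 is at distance (m + 2) e from the start and
   the optimum is at most 2 (m + 2) e, while the agent that entered the long edge
   is not back before T + 1 + (m + 1) e, which is about 2 m e + 1 with m e < 1. *)
From HB Require Import structures.
Require Import Defs.
From mathcomp Require Import all_boot all_order all_algebra.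
From mathcomp Require Import finmap.
From mathcomp Require Import all_classical all_reals all_analysis.
From mathcomp Require Import zify lra.
Import Order.TTheory GRing.Theory Num.Theory.
Local Open Scope ring_scope.
Local Open Scope classical_set_scope.

Set Implicit Arguments.
Unset Strict Implicit.
Unset Printing Implicit Defensive.

(** * Travel-time bounds from potentials *)

(** Any function that grows along each edge by at most its length bounds travel times from below, so
    exact distances are never computed. *)
Lemma arrivals_potential (R : realType) (G : graph R) (phi : nat -> R)
    (r : R) (x : nat) (p : itinerary R) (a : R) (v : nat) :
  (forall u w, edge G u w -> phi w <= phi u + len G u w) ->
  feasible G r x p -> (a, v) \in arrivals G x p -> r + phi v <= a + phi x.
Proof.
move=> lip; elim: p r x => [|[d y] q IH] r x //= /and3P[rd exy fq].
have := lip _ _ exy; rewrite inE => lxy /orP[/eqP[-> ->]|/(IH _ _ fq)]; lra.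
Qed.

Lemma at_node_potential (R : realType) (G : graph R) (phi : nat -> R)
    (r : R) (x : nat) (p : itinerary R) (t : R) (v : nat) :
  (forall u w, edge G u w -> phi u <= phi w + len G u w) ->
  feasible G r x p -> r <= t -> at_node G x p t v -> r + phi x <= t + phi v.
Proof.
move=> lip; elim: p r x => [|[d y] q IH] r x /=.
  by move=> _ rt /eqP->; lra.
move=> /and3P[rd exy fq] rt; case: ifP => [_ /eqP->|_ /andP[dt aq]]; first lra.
by have := lip _ _ exy; have := IH _ _ fq dt aq; lra.
Qed.

Lemma departure_ge (R : realType) (G : graph R) (r : R) (x : nat)
    (p : itinerary R) (d : R) (y : nat) :
  feasible G r x p -> (d, y) \in p -> r <= d.
Proof.
elim: p r x => [|[d' y'] q IH] r x //= /and3P[rd exy fq].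
rewrite inE => /orP[/eqP[-> _]//|/(IH _ _ fq)].
by have := len_gt0 exy; lra.
Qed.

(** An itinerary records only targets, hence the existential departure node [z]. With [psi]
    quantified under it, one [z] serves both the way to the departure and the way back after it. *)
Lemma departure_at_node (R : realType) (G : graph R) (phi : nat -> R)
    (r : R) (x : nat) (p : itinerary R) (d : R) (y : nat) :
  (forall u w, edge G u w -> phi w <= phi u + len G u w) ->
  feasible G r x p -> (d, y) \in p ->
  exists z, [/\ edge G z y, r + phi z <= d + phi x &
    forall (psi : nat -> R) t v,
      (forall u w, edge G u w -> psi u <= psi w + len G u w) ->
      d < t -> at_node G x p t v -> d + len G z y + psi y <= t + psi v].
Proof.
move=> lip; elim: p r x => [|[d' y'] q IH] r x //= /and3P[rd exy fq].
have lxy := lip _ _ exy.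
rewrite inE => /orP[/eqP[-> ->]|dq]; last have [z [ezy zd H]] := IH _ _ fq dq.
  exists x; split=> //; first lra.
  move=> psi t v lipp dt; case: ifP => [|_ /andP[dt' aq]]; first lra.
  exact: at_node_potential lipp fq dt' aq.
exists z; split=> //; first lra.
move=> psi t v lipp dt; case: ifP => [td|_ /andP[_ aq]]; last exact: H.
(* [d] is not before [d' + len], so [t <= d'] contradicts [d < t] *)
by have := departure_ge fq dq; have := len_gt0 exy; lra.
Qed.

(** * Moves begun by a given time determine the near future *)

(** A traversal begun after [t] lasts at least [e], so it ends after [t + e]. *)
Lemma arrivals_filter (R : realType) (G : graph R) (r : R) (x : nat)
    (p : itinerary R) (e t a : R) (v : nat) :
  (forall u w, edge G u w -> e <= len G u w) ->
  feasible G r x p -> (a, v) \in arrivals G x p -> a <= t + e ->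
  (a, v) \in arrivals G x [seq m <- p | m.1 <= t].
Proof.
move=> le; elim: p r x => [|[d y] q IH] r x //= /and3P[rd exy fq].
have lxy := le _ _ exy.
rewrite inE; case: (leP d t) => dt /= /orP[/eqP[-> ->]|aq] at_.
- by rewrite inE eqxx.
- by rewrite inE (IH _ _ fq aq at_) orbT.
- lra.
(* The zero potential yields [d + len G x y <= a], contradicting [a <= t + e]. *)
- have := @arrivals_potential _ G (fun=> 0) _ _ _ _ _ _ fq aq.
  have l0 u w : edge G u w -> (0 : R) <= 0 + len G u w by move=> /len_gt0; lra.
  by move=> /(_ l0); lra.
Qed.

Lemma filter_late (R : realType) (G : graph R) (r t : R) (x : nat)
    (p : itinerary R) :
  feasible G r x p -> t < r -> [seq m <- p | m.1 <= t] = [::].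
Proof.
move=> fp tr; apply/eqP; rewrite -[_ == _]negbK -has_filter.
by apply/hasPn => -[d y] /(departure_ge fp) /=; lra.
Qed.

Lemma arrivals_of_filter (R : realType) (G : graph R) (r : R) (x : nat)
    (p : itinerary R) (t a : R) (v : nat) :
  feasible G r x p ->
  (a, v) \in arrivals G x [seq m <- p | m.1 <= t] -> (a, v) \in arrivals G x p.
Proof.
elim: p r x => [|[d y] q IH] r x //= /and3P[rd exy fq].
have l0 := len_gt0 exy.
case: (leP d t) => dt /=; last by rewrite (filter_late fq) //; lra.
by rewrite !inE => /orP[->//|/(IH _ _ fq)->]; rewrite orbT.
Qed.

Lemma eq_arrivals (R : realType) (G H : graph R) (x : nat) (p : itinerary R) :
  (forall u v, len G u v = len H u v) -> arrivals G x p = arrivals H x p.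
Proof. by move=> eqlen; elim: p x => [|[d y] q IH] x //=; rewrite eqlen IH. Qed.

Lemma visited_le (R : realType) (k : nat) (G : graph R) s (S : schedule R k)
    (t t' : R) (v : nat) :
  t <= t' -> visited G s S t v -> visited G s S t' v.
Proof.
move=> tt' [->|[i [a [aS at_]]]]; first by left.
by right; exists i, a; split => //; apply: le_trans tt'.
Qed.

Lemma visited_next (R : realType) (k : nat) (G H : graph R) s
    (S S' : schedule R k) (e t t' : R) (v : nat) :
  (forall u w, edge G u w -> e <= len G u w) ->
  (forall u w, len G u w = len H u w) ->
  valid G s S -> valid H s S' ->
  (forall i, [seq m <- S i | m.1 <= t] = [seq m <- S' i | m.1 <= t]) ->
  t' <= t + e -> visited G s S t' v -> visited H s S' t' v.
Proof.
move=> le eqlen vG vH eqm t't [->|[i [a [aS at_]]]]; first by left.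
right; exists i, a; split=> //.
have := arrivals_filter le (vG i) aS (le_trans at_ t't).
by rewrite eqm (eq_arrivals _ _ eqlen) => /(arrivals_of_filter (vH i)).
Qed.

(* By induction on the number of time steps of length [e]: since no traversal is
   shorter than [e], knowledge up to [t] determines knowledge up to [t + e]. *)
Lemma same_knowledge (R : realType) (k : nat) (C : set (graph R))
    (A : strategy R k) (G H : graph R) (s : nat) (e T : R) :
  online_exploration_strategy C A -> C G -> C H ->
  s \in nodes G -> s \in nodes H -> 0 < e ->
  (forall u w, edge G u w -> e <= len G u w) ->
  (forall u w, edge H u w -> e <= len H u w) ->
  (forall u w, len G u w = len H u w) ->
  (forall v u, visited H s (A H s) T v -> edge G v u = edge H v u) ->
  forall t, t <= T -> knowledge G s (A G s) t = knowledge H s (A H s) t.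
Proof.
move=> [expl nonant] CG CH sG sH e0 leG leH eqlen eqedge.
have [vG _] := expl _ _ CG sG.
have [vH _] := expl _ _ CH sH.
(* Equal visited sets suffice, since [eqlen] and [eqedge] make the edges at visited nodes agree. *)
have eqk t : t <= T ->
    (forall v, visited G s (A G s) t v <-> visited H s (A H s) t v) ->
    knowledge G s (A G s) t = knowledge H s (A H s) t.
  move=> tT eqv; rewrite /knowledge.
  have -> : visited G s (A G s) t = visited H s (A H s) t.
    by apply/seteqP; split=> v /eqv.
  congr (_, _); apply/seteqP; split=> -[[u v] l] /= [vu].
    by rewrite eqlen eqedge //; apply: visited_le vu.
  by rewrite -eqlen -eqedge //; apply: visited_le vu.
suff main n t : t <= T -> t <= e *+ n ->
    knowledge G s (A G s) t = knowledge H s (A H s) t.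
  move=> t tT; apply: (main (Num.truncn (`|t| / e)).+1) => //.
  rewrite -mulr_natr mulrC -ler_pdivrMr //.
  apply: le_trans (ltW (truncnS_gt _)).
  by rewrite ler_pM2r ?invr_gt0 ?ler_norm.
elim: n t => [|n IH] t tT te; apply: eqk => // v.
  (* Here [t <= 0]: an arrival by [t] would need a departure by [t - e < 0], so only the start is
     visited. *)
  have none (K : graph R) (S : schedule R k) (u : nat) :
      (forall u w, edge K u w -> e <= len K u w) ->
      valid K s S -> visited K s S t u -> u = s.
    move=> leK vK [//|[i [a [aS at_]]]].
    have te0 : t - e < 0.
      by rewrite mulr0n in te; lra.
    have ate : a <= t - e + e by rewrite subrK.
    by have := arrivals_filter leK (vK i) aS ate; rewrite (filter_late (vK i)).
  by split=> /none -> //; left.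
(* The induction hypothesis reaches only up to [T], hence the minimum. *)
have eqm i : [seq m <- A G s i | m.1 <= Num.min T (e *+ n)] =
             [seq m <- A H s i | m.1 <= Num.min T (e *+ n)].
  apply: nonant => // t'; rewrite le_min => /andP[]; exact: IH.
have t_le : t <= Num.min T (e *+ n) + e.
  by rewrite mulrS in te; rewrite -lerBlDr le_min; apply/andP; split; lra.
by split; apply: visited_next t_le.
Qed.

(** * Upper bounds on the optimum from walks *)

Fixpoint tour (R : realType) (G : graph R) (r : R) (x : nat) (p : seq nat) :
    itinerary R :=
  if p is y :: q then (r, y) :: tour G (r + len G x y) y q else [::].

Fixpoint walk_len (R : realType) (G : graph R) (x : nat) (p : seq nat) : R :=
  if p is y :: q then len G x y + walk_len G y q else 0.

Lemma walk_len_ge0 (R : realType) (G : graph R) (x : nat) (p : seq nat) :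
  path (edge G) x p -> 0 <= walk_len G x p.
Proof.
elim: p x => [|y q IH] x //= /andP[exy pq].
by rewrite addr_ge0 ?IH ?ltW ?len_gt0.
Qed.

Lemma walk_len_cat (R : realType) (G : graph R) (x : nat) (p q : seq nat) :
  walk_len G x (p ++ q) = walk_len G x p + walk_len G (last x p) q.
Proof. by elim: p x => [|y p IH] x /=; rewrite ?add0r // IH addrA. Qed.

Lemma walk_len_rev (R : realType) (G : graph R) (x : nat) (p : seq nat) :
  path (edge G) x p ->
  walk_len G (last x p) (rev (belast x p)) = walk_len G x p.
Proof.
elim: p x => [|y q IH] x //= /andP[exy pq].
rewrite rev_cons -cats1 walk_len_cat IH //= addr0 addrC.
case: q pq {IH} => [|z q] _ /=; first by rewrite (len_sym exy).
by rewrite rev_cons last_rcons (len_sym exy).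
Qed.

(** From the end of [p], the nodes of [rev (belast x p)] lead back to [x]. *)
Definition round_trip (x : nat) (p : seq nat) := p ++ rev (belast x p).

Lemma round_trip_path (R : realType) (G : graph R) (x : nat) (p : seq nat) :
  path (edge G) x p -> path (edge G) x (round_trip x p).
Proof.
move=> xp; rewrite /round_trip cat_path xp rev_path.
by rewrite (eq_path (e' := edge G)) // => u v; rewrite edge_sym.
Qed.

Lemma last_round_trip (x : nat) (p : seq nat) : last x (round_trip x p) = x.
Proof.
by rewrite last_cat; case: p => [//|y q] /=; rewrite rev_cons last_rcons.
Qed.

Lemma walk_len_round_trip (R : realType) (G : graph R) (x : nat) (p : seq nat) :
  path (edge G) x p -> walk_len G x (round_trip x p) = walk_len G x p *+ 2.
Proof. by move=> xp; rewrite walk_len_cat walk_len_rev // mulr2n. Qed.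

Lemma tour_feasible (R : realType) (G : graph R) (r : R) (x : nat)
    (p : seq nat) :
  path (edge G) x p -> feasible G r x (tour G r x p).
Proof. by elim: p r x => [|y q IH] r x //= /andP[-> /IH->]; rewrite lexx. Qed.

Lemma tour_at_node (R : realType) (G : graph R) (r t : R) (x : nat)
    (p : seq nat) :
  path (edge G) x p -> r + walk_len G x p <= t ->
  at_node G x (tour G r x p) t (last x p).
Proof.
elim: p r x => [|y q IH] r x //= /andP[exy pq] rt.
have := walk_len_ge0 pq; have := len_gt0 exy => l0 w0.
by case: leP => tr; [lra | rewrite IH // ?andbT; lra].
Qed.

Lemma tour_arrivals (R : realType) (G : graph R) (r : R) (x v : nat)
    (p : seq nat) :
  path (edge G) x p -> v \in p ->
  exists2 a, (a, v) \in arrivals G x (tour G r x p) & a <= r + walk_len G x p.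
Proof.
elim: p r x => [|y q IH] r x //= /andP[exy pq].
rewrite inE => /orP[/eqP->|/(IH (r + len G x y) _ pq)[a aq ale]].
  exists (r + len G x y); first by rewrite inE eqxx.
  by have := walk_len_ge0 pq; lra.
by exists a; [rewrite inE aq orbT | lra].
Qed.

Lemma cost_le (R : realType) (k : nat) (G : graph R) (s : nat)
    (S : schedule R k) (t : R) : finished G s S t -> cost G s S <= t.
Proof. by move=> fin; apply: ge_inf => //; exists 0 => ? []. Qed.

Lemma cost_ge (R : realType) (k : nat) (G : graph R) (s : nat)
    (S : schedule R k) (c : R) :
  exploration G s S -> (forall t, finished G s S t -> c <= t) ->
  c <= cost G s S.
Proof. by move=> [_ ?] ?; apply: lb_le_inf. Qed.

(** Agent [i] walks [P i] out and back without waiting, so all are home by [l *+ 2]. *)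
Lemma opt_le (R : realType) (k : nat) (G : graph R) (s : nat)
    (P : 'I_k -> seq nat) (l : R) :
  (forall i, path (edge G) s (P i)) ->
  (forall v, v \in nodes G -> v != s -> exists i, v \in P i) ->
  0 <= l -> (forall i, walk_len G s (P i) <= l) ->
  opt G s k <= l *+ 2.
Proof.
move=> pathP nodesP l0 lP.
pose S : schedule R k := fun i => tour G 0 s (round_trip s (P i)).
have fin : finished G s S (l *+ 2).
  split; first by rewrite mulrn_wge0.
    move=> v vG; have [->|vs] := eqVneq v s; first by left.
    have [i vi] := nodesP _ vG vs; right; exists i.
    have [|a av ale] := tour_arrivals 0 (round_trip_path (pathP i)) (v := v).
      by rewrite mem_cat vi.
    exists a; split=> //; apply: le_trans ale _.
    by rewrite add0r walk_len_round_trip // lerMn2r lP orbT.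
  move=> i; rewrite -[X in at_node _ _ _ _ X](last_round_trip s (P i)).
  apply: tour_at_node; first exact: round_trip_path.
  by rewrite add0r walk_len_round_trip // lerMn2r lP.
apply: le_trans (cost_le fin); apply: ge_inf.
  exists 0 => _ [S' [vS' exS'] <-].
  by apply: cost_ge => // t [].
exists S => //; split; last by exists (l *+ 2).
by move=> i; apply: tour_feasible; apply: round_trip_path.
Qed.

(** * Lower bounds on visiting times and on the optimum *)

Lemma visited_potential (R : realType) (k : nat) (G : graph R) (s v : nat)
    (S : schedule R k) (phi : nat -> R) (t : R) :
  (forall u w, edge G u w -> phi w <= phi u + len G u w) ->
  valid G s S -> 0 <= t -> visited G s S t v -> phi v <= t + phi s.
Proof.
move=> lip vS t0 [->|[i [a [aS at_]]]]; first by rewrite lerDr.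
by have := arrivals_potential lip (vS i) aS; lra.
Qed.

(** Some agent must reach [v]. An exploration has to exist because the infimum of the empty set is
    the default [0]. *)
Lemma opt_ge (R : realType) (k : nat) (G : graph R) (s v : nat)
    (phi : nat -> R) :
  (exists S : schedule R k, exploration G s S) ->
  (forall u w, edge G u w -> phi w <= phi u + len G u w) ->
  v \in nodes G -> phi v <= opt G s k + phi s.
Proof.
move=> [S0 ES0] lip vG; rewrite -lerBlDr; apply: lb_le_inf.
  by exists (cost G s S0), S0.
move=> _ [S ES <-]; apply: cost_ge => // t [t0 vis _].
by rewrite lerBlDr; apply: (visited_potential lip ES.1 t0 (vis _ vG)).
Qed.

(** * The two tadpoles as a path with a chord *)

(** The path [0, ..., n] with an extra edge between [a] and [b]. Both instances have this shape and
    differ only in [n] and the chord. *)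
Definition chord_edge (n a b : nat) : rel nat := fun u v =>
  [&& (u <= n)%N, (v <= n)%N, u != v &
    [|| v == u.+1, u == v.+1, (u == a) && (v == b) | (u == b) && (v == a)]].

(* Length 1 on the edge {0, 1}. *)
Definition chord_len (R : realType) (N u v : nat) : R :=
  if (u + v == 1)%N then 1 else N.+1%:R^-1.

Lemma chord_edge_sym (n a b : nat) : symmetric (chord_edge n a b).
Proof.
move=> u v; rewrite /chord_edge (andbCA (u <= n)%N) (eq_sym u v).
by rewrite orbCA (orbC (_ && _)) (andbC (u == a)) (andbC (u == b)).
Qed.

Lemma chord_edge_up (n a b u : nat) : (u < n)%N -> chord_edge n a b u u.+1.
Proof. by move=> un; rewrite /chord_edge un (ltnW un) ltn_eqF // eqxx. Qed.

Lemma chord_edge_path (n a b u l : nat) :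
  (u + l <= n)%N -> path (chord_edge n a b) u (iota u.+1 l).
Proof.
elim: l u => [//|l IH] u /=; rewrite -addSnnS => ul.
by rewrite chord_edge_up ?IH //; apply: leq_trans ul; rewrite leq_addr.
Qed.

Lemma last_iota (u l : nat) : last u (iota u.+1 l) = (u + l)%N.
Proof. by elim: l u => [|l IH] u /=; rewrite ?addn0 // IH addnS. Qed.

Definition chord_graph (R : realType) (N n a b : nat) : graph R.
Proof.
refine (@Graph R [fset i in iota 0 n.+1]%fset (chord_edge n a b)
  (@chord_len R N) _ _ _ _ _ _).
- by move=> u v /and4P[un _ _ _]; rewrite in_fset mem_iota.
- exact: chord_edge_sym.
- by move=> u; rewrite /chord_edge eqxx !andbF.
- by move=> u v _; rewrite /chord_len addnC.
- by move=> u v _; rewrite /chord_len; case: ifP => // _; rewrite invr_gt0.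
move=> u v; rewrite !in_fset !mem_iota !add0n !ltnS /= => un vn.
have up w : (w <= n)%N -> path (chord_edge n a b) 0 (iota 1 w).
  by move=> wn; apply: chord_edge_path.
(* The walk descends from [u] to [0], then climbs to [v]. *)
exists (rev (belast 0%N (iota 1 u)) ++ iota 1 v); rewrite cat_path last_cat.
have -> : last u (rev (belast 0%N (iota 1 u))) = 0%N.
  by case: u {un} => [//|u]; rewrite /= rev_cons last_rcons.
rewrite up // andbT last_iota add0n; split=> //.
have := rev_path (chord_edge n a b) 0 (iota 1 u); rewrite last_iota => ->.
by rewrite (eq_path (e' := chord_edge n a b)) ?up // => x y; apply: chord_edge_sym.
Defined.

Lemma nodes_chord (R : realType) (N n a b u : nat) :
  (u \in nodes (chord_graph R N n a b)) = (u <= n)%N.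
Proof. by rewrite in_fset mem_iota. Qed.

Lemma cycle_succ_iota (n u v : nat) :
  cycle_succ (iota 0 n.+1) u v =
  (u <= n)%N && (v == if u == n then 0%N else u.+1).
Proof.
rewrite /cycle_succ mem_iota leq0n add0n ltnS; case: leqP => // un.
have u_in : u \in iota 0 n.+1 by rewrite mem_iota ltnS.
have iu : index u (iota 0 n.+1) = u.
  have := @index_uniq _ 0%N u (iota 0 n.+1).
  by rewrite size_iota nth_iota // add0n; apply=> //; apply: iota_uniq.
congr (_ == _).
rewrite next_nth u_in iu /=.
(* At the last node [nth] runs off the list, and its default [0] closes the cycle. *)
have [->|neq] := eqVneq u n; first by rewrite nth_default ?size_iota.
by rewrite nth_iota //; lia.
Qed.

Lemma path_succ_cons (x y u v : nat) (p : seq nat) :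
  path_succ [:: x, y & p] u v =
  (u == x) && (v == y) || path_succ (y :: p) u v.
Proof. by rewrite /path_succ /= inE. Qed.

Lemma path_succ_rev_iota (n u v : nat) :
  path_succ (rev (iota 0 n.+1)) u v = (u == v.+1) && (v < n)%N.
Proof.
elim: n => [|n IH]; first by rewrite /path_succ /= in_nil ltn0 andbF.
rewrite -(addn1 n.+1) iotaD rev_cat /= add0n.
have rE : rev (iota 0 n.+1) = n :: rev (iota 0 n).
  by rewrite -(addn1 n) iotaD rev_cat /= add0n.
by move: IH; rewrite rE path_succ_cons => ->; lia.
Qed.

Lemma tadpole_chord_hi (R : realType) (N n : nat) :
  tadpole (chord_graph R N (n + 3) (n + 1) (n + 3)).
Proof.
have t_mem u : (u \in rev (iota 0 n.+1)) = (u <= n)%N.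
  by rewrite mem_rev mem_iota.
have t_uniq : uniq (rev (iota 0 n.+1)) by rewrite rev_uniq iota_uniq.
have t_size : size (rev (iota 0 n.+1)) = n.+1 by rewrite size_rev size_iota.
have t_succ u v : path_succ (n.+1 :: rev (iota 0 n.+1)) u v =
    (u == v.+1) && (v < n.+1)%N.
  by rewrite -path_succ_rev_iota -(addn1 n.+1) iotaD rev_cat /= add0n.
(* The chord closes a triangle at the far end; the tail descends from it to [0]. *)
exists n.+1, [:: n.+2; n.+3], (rev (iota 0 n.+1)).
move: (rev _) t_mem t_uniq t_size t_succ => t t_mem t_uniq t_size t_succ.
split=> //; first by rewrite t_size.
- by rewrite /= !inE !t_mem t_uniq; lia.
- by move=> u; rewrite nodes_chord !in_cons t_mem; lia.
move=> u v; rewrite !t_succ /= /chord_edge /cycle_succ /next /= !inE.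
by have [?|?] := eqVneq u n.+1; have [?|?] := eqVneq u n.+2;
  have [?|?] := eqVneq u n.+3; have [?|?] := eqVneq v n.+1;
  have [?|?] := eqVneq v n.+2; have [?|?] := eqVneq v n.+3; lia.
Qed.

Lemma tadpole_chord_lo (R : realType) (N n : nat) :
  tadpole (chord_graph R N (n + 3) 0 (n + 2)).
Proof.
(* The chord closes the cycle [0, ..., n.+2]; the tail is the single edge to [n.+3]. *)
exists n.+2, (iota 0 n.+2), [:: n.+3].
(* Listed from the intersection, the cycle is a rotation of [iota 0 n.+3], which leaves [next]
   unchanged. *)
have rE : n.+2 :: iota 0 n.+2 = rotr 1 (iota 0 n.+3).
  by rewrite -[in RHS](addn1 n.+2) iotaD cats1 rotr1_rcons.
have cE u v : cycle_succ (n.+2 :: iota 0 n.+2) u v = cycle_succ (iota 0 n.+3) u v.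
  by rewrite rE /cycle_succ mem_rotr next_rotr ?iota_uniq.
split.
- by rewrite size_iota.
- by [].
- rewrite cats1 cons_uniq rcons_uniq mem_rcons in_cons !mem_iota iota_uniq.
  by rewrite !add0n !ltnn (ltnNge _.+1) leqnSn (ltn_eqF (ltnSn _)).
- by move=> u; rewrite nodes_chord in_cons mem_cat mem_iota mem_seq1; lia.
move=> u v; rewrite !cE !cycle_succ_iota /path_succ /= !inE /chord_edge !xpair_eqE.
by have [?|?] := eqVneq u n.+2; have [?|?] := eqVneq v n.+2; lia.
Qed.

(** * The cost of reaching node 0 and returning *)

Lemma arrival_departure (R : realType) (G : graph R) (r : R) (x : nat)
    (p : itinerary R) (a : R) (v : nat) :
  feasible G r x p -> (a, v) \in arrivals G x p ->
  exists2 d, (d, v) \in p & d < a.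
Proof.
elim: p r x => [|[d y] q IH] r x //= /and3P[_ exy fq].
rewrite inE => /orP[/eqP[-> ->]|/(IH _ _ fq)[d' dq da]].
  by exists d; [rewrite inE eqxx | have := len_gt0 exy; lra].
by exists d' => //; rewrite inE dq orbT.
Qed.

(* A lower bound on the distance from node 1, in units of [1 / N.+1]. *)
Definition level (M j : nat) : nat := if j is i.+1 then minn i M else M.

Definition pot (R : realType) (N M j : nat) : R := (level M j)%:R / N.+1%:R.

(** Path edges other than [{0, 1}] change the level by at most one; [{0, 1}] is worth [N.+1] units,
    enough for any change up to [M]; the chord joins equal levels. *)
Lemma pot_lip (R : realType) (N n a b M u v : nat) :
  (M <= N.+1)%N -> level M a = level M b -> edge (chord_graph R N n a b) u v ->
  pot R N M v <= pot R N M u + len (chord_graph R N n a b) u v.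
Proof.
move=> MN Mab /= /and4P[_ _ uv euv]; rewrite /pot /chord_len.
have K0 : (0 : R) < N.+1%:R by rewrite ltr0n.
case: ifP => uv1.
  rewrite ler_pdivrMr // mulrDl divfK ?gt_eqF // mul1r -natrD ler_nat.
  by case: u v uv1 {uv euv} => [|u] [|v] //=; lia.
rewrite -[X in _ + X]mul1r -mulrDl ler_pM2r ?invr_gt0 // natr1 ler_nat.
case/or4P: euv => [/eqP vE|/eqP uE|/andP[/eqP-> /eqP->]|/andP[/eqP-> /eqP->]].
- by case: u v vE uv1 {uv} => [|u] [|v] //=; lia.
- by case: u v uE uv1 {uv} => [|u] [|v] //=; lia.
- by rewrite Mab.
- by rewrite Mab.
Qed.

Lemma pot_lip_sym (R : realType) (N n a b M u v : nat) :
  (M <= N.+1)%N -> level M a = level M b -> edge (chord_graph R N n a b) u v ->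
  pot R N M u <= pot R N M v + len (chord_graph R N n a b) u v.
Proof.
by move=> MN Mab euv; rewrite (len_sym euv) pot_lip // edge_sym.
Qed.

Lemma chord_len_ge (R : realType) (N u v : nat) :
  N.+1%:R^-1 <= chord_len R N u v.
Proof.
rewrite /chord_len; case: ifP => // _.
by rewrite invf_le1 ?ltr0n // ler1n.
Qed.

Lemma walk_len_iota (R : realType) (N n a b u l : nat) :
  walk_len (chord_graph R N n a b) u.+1 (iota u.+2 l) = l%:R / N.+1%:R.
Proof.
elim: l u => [|l IH] u /=; first by rewrite mul0r.
rewrite IH [chord_len _ _ _ _]/chord_len ifN; last by lia.
by rewrite -[in RHS]addn1 natrD mulrDl mul1r addrC.
Qed.

(** By time [d] only neighbour 1 of node 0 can have been reached, so the agent takes the edge of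
    length 1 and then has at least [M] units left to get home. *)
Lemma crossing_cost (R : realType) (k N n a b M : nat) (S : schedule R k)
    (i : 'I_k) (d t : R) :
  (M <= N.+1)%N -> level M a = level M b ->
  valid (chord_graph R N n a b) 1 S ->
  finished (chord_graph R N n a b) 1 S t ->
  (d, 0%N) \in S i -> d < t ->
  (forall z, chord_edge n a b z 0 -> pot R N M z <= d -> z = 1%N) ->
  d + 1 + M%:R / N.+1%:R <= t.
Proof.
move=> MN Mab vS [_ _ /(_ i) at1] dS dt z1.
have pot1 : pot R N M 1 = 0 by rewrite /pot /level /= min0n mul0r.
have lip u w := @pot_lip R N n a b M u w MN Mab.
have lip' u w := @pot_lip_sym R N n a b M u w MN Mab.
have [z [ez0]] := departure_at_node lip (vS i) dS.
rewrite add0r pot1 addr0 => /(z1 _ ez0) z_1.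
move: ez0; rewrite {z}z_1 => e10 /(_ _ _ _ lip' dt at1).
by rewrite pot1 addr0.
Qed.

Lemma opt_chord_gt0 (R : realType) (k N n a b M : nat) :
  (M <= N.+1)%N -> level M a = level M b -> (0 < M)%N ->
  (exists S : schedule R k, exploration (chord_graph R N n a b) 1 S) ->
  0 < opt (chord_graph R N n a b) 1 k.
Proof.
move=> MN Mab M0 ex.
have lip u w := @pot_lip R N n a b M u w MN Mab.
have := opt_ge (v := 0%N) ex lip.
rewrite nodes_chord {2}/pot /level /= min0n mul0r addr0 => /(_ isT).
by apply: lt_le_trans; rewrite divr_gt0 ?ltr0n.
Qed.

(** * Upper bounds on the two optima *)

Lemma opt_chord_hi (R : realType) (k N : nat) : (2 <= k)%N ->
  opt (chord_graph R N (N.+1 + 3) (N.+1 + 1) (N.+1 + 3)) 1 k <=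
  (1 + 2 / N.+1%:R) *+ 2.
Proof.
move=> k2; have K0 : (0 : R) < N.+1%:R by rewrite ltr0n.
(* One agent visits node 0, the others walk to the far end, [N + 3] short edges away. *)
apply: (opt_le (P := fun i : 'I_k =>
  if val i == 0%N then [:: 0%N] else iota 2 (N.+1 + 2))).
- move=> i; case: ifP => _; first by rewrite /= /chord_edge /=.
  by apply: chord_edge_path; lia.
- move=> v; rewrite nodes_chord => vn v1; case: (posnP v) => [->|v0].
    by exists (Ordinal (ltnW k2)); rewrite /= inE.
  by exists (Ordinal k2); rewrite [_ == _]/= mem_iota; lia.
- by rewrite addr_ge0 ?divr_ge0.
move=> i; case: ifP => _.
  by rewrite [walk_len _ _ _]/= /chord_len /= lerD2l divr_ge0.
by rewrite walk_len_iota natrD mulrDl divff ?gt_eqF.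
Qed.

Lemma opt_chord_lo (R : realType) (k N m : nat) : (2 <= k)%N ->
  opt (chord_graph R N (m + 3) 0 (m + 2)) 1 k <=
  ((m + 2)%:R / N.+1%:R) *+ 2.
Proof.
move=> k2; have K0 : (0 : R) < N.+1%:R by rewrite ltr0n.
(* The long edge is avoided: one agent reaches 0 over the chord, the others walk to the tail's end,
   each using [m + 2] short edges. *)
apply: (opt_le (P := fun i : 'I_k =>
  if val i == 0%N then rcons (iota 2 m.+1) 0%N else iota 2 (m + 2))).
- move=> i; case: ifP => _; last by apply: chord_edge_path; lia.
  rewrite rcons_path last_iota; apply/andP; split.
    by apply: chord_edge_path; lia.
  by rewrite [edge _ _ _]/= /chord_edge; lia.
- move=> v; rewrite nodes_chord => vn v1; case: (posnP v) => [->|v0].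
    by exists (Ordinal (ltnW k2)); rewrite [_ == _]/= mem_rcons inE.
  by exists (Ordinal k2); rewrite [_ == _]/= mem_iota; lia.
- by rewrite divr_ge0.
move=> i; case: ifP => _; last by rewrite walk_len_iota.
rewrite -cats1 walk_len_cat walk_len_iota last_iota.
have -> : walk_len (chord_graph R N (m + 3) 0 (m + 2)) (1 + m.+1) [:: 0%N] =
    N.+1%:R^-1.
  by rewrite [LHS]addr0.
by rewrite -[X in _ + X]mul1r -mulrDl natr1 addn2.
Qed.

Lemma chord_edge_hi0 (n z : nat) :
  chord_edge (n.+1 + 3) (n.+1 + 1) (n.+1 + 3) z 0 -> z = 1%N.
Proof. by rewrite /chord_edge => /and4P[]; lia. Qed.

Lemma chord_edge_lo0 (m z : nat) :
  chord_edge (m + 3) 0 (m + 2) z 0 -> z = 1%N \/ z = (m + 2)%N.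
Proof. by rewrite /chord_edge => /and4P[]; lia. Qed.

(** The chord ends [0], [m + 2] and [n + 1], [n + 3] all differ from [v], so both graphs show only
    path edges there. *)
Lemma chord_edge_agree (n m v u : nat) :
  (m < n)%N -> (0 < v <= m.+1)%N ->
  chord_edge (m + 3) 0 (m + 2) v u = chord_edge (n + 3) (n + 1) (n + 3) v u.
Proof. by rewrite /chord_edge; lia. Qed.

(** * The adversary argument *)

Lemma ratio_ge (R : realType) (c o C o' y : R) :
  0 < o -> o <= o' -> C <= c -> 0 <= y -> y * o' <= C -> y <= c / o.
Proof.
move=> o0 oo' Cc y0 yo; rewrite ler_pdivlMr //.
by apply: le_trans Cc; apply: le_trans yo; apply: ler_wpM2l.
Qed.

Lemma hard_instance (R : realType) (k : nat) (A : strategy R k) (N : nat) :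
  (2 <= k)%N -> online_exploration_strategy (@tadpole R) A -> (5 <= N)%N ->
  exists G s, [/\ tadpole G, s \in nodes G &
    3 / 2 - 3 / N.+1%:R <= cost G s (A G s) / opt G s k].
Proof.
move=> k2 onA N5; set e : R := N.+1%:R^-1.
have K0 : (0 : R) < N.+1%:R by rewrite ltr0n.
have e0 : 0 < e by rewrite invr_gt0.
have e6 : e * 6 <= 1.
  by rewrite mulrC ler_pdivrMr // mul1r ler_nat.
have Ke : N.+1%:R * e = 1 by rewrite divff ?gt_eqF.
have lene n a b u w : edge (chord_graph R N n a b) u w ->
    e <= len (chord_graph R N n a b) u w.
  by move=> _; apply: chord_len_ge.
pose H := chord_graph R N (N.+1 + 3) (N.+1 + 1) (N.+1 + 3).
have tH : tadpole H by apply: tadpole_chord_hi.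
have sH : 1%N \in nodes H by rewrite nodes_chord.
have lvH : level N.+1 (N.+1 + 1) = level N.+1 (N.+1 + 3).
  by rewrite addn1 addn3 /=; lia.
have exH := onA.1 _ _ tH sH.
have [[i [T AT T1]]|late] :=
  pselect (exists i, exists2 T, (T, 0%N) \in A H 1%N i & T < 1); last first.
  exists H, 1%N; split=> //.
  apply: (@ratio_ge _ _ _ 3 ((1 + 2 / N.+1%:R) *+ 2)).
  - by apply: (@opt_chord_gt0 _ _ _ _ _ _ N.+1) => //; exists (A H 1%N).
  - exact: opt_chord_hi.
  - apply: cost_ge => // t fin.
    have [_ /(_ 0%N) vis _] := fin; move: vis; rewrite nodes_chord => /(_ isT).
    case=> // -[i [a [/(arrival_departure (exH.1 i))[d dA da] at_]]].
    (* Departure at 1 or later, crossing time 1 and a way home of [N.+1] units, also 1, add up to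
       3. *)
    have d1 : 1 <= d by rewrite leNgt; apply/negP => d1; apply: late; exists i, d.
    have := crossing_cost (M := N.+1) (leqnn _) lvH exH.1 fin dA.
    rewrite divff ?gt_eqF // => /(_ (lt_le_trans da at_)) cr.
    suff: d + 1 + 1 <= t by lra.
    by apply: cr => z /chord_edge_hi0.
  - by rewrite -/e; lra.
  (* The loss [3 e] cancels the linear term: [(3 / 2 - 3 e) (2 + 4 e) = 3 - 12 e^2]. *)
  - rewrite -/e; nra.
have T0 : 0 <= T by apply: departure_ge (exH.1 i) AT.
pose m := Num.truncn (T * N.+1%:R).
have /andP[mT Tm] : m%:R <= T * N.+1%:R < m.+1%:R.
  by apply: truncn_itv; rewrite mulr_ge0.
have mN : (m < N.+1)%N.
  rewrite -(ltr_nat R); apply: le_lt_trans mT _.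
  by rewrite gtr_pMl.
have {}mT : m%:R * e <= T by rewrite ler_pdivrMr.
have {}Tm : T < m.+1%:R * e by rewrite ltr_pdivlMr.
pose G := chord_graph R N (m + 3) 0 (m + 2).
have tG : tadpole G by apply: tadpole_chord_lo.
have sG : 1%N \in nodes G by rewrite nodes_chord addn3.
(* The chord ends must share a level, so node 0 is counted as only [m.+1] units away, like node
   [m + 2]. *)
have lvG : level m.+1 0 = level m.+1 (m + 2) by rewrite addn2 /= minnn.
have exG := onA.1 _ _ tG sG.
have know : forall t, t <= T ->
    knowledge G 1%N (A G 1%N) t = knowledge H 1%N (A H 1%N) t.
  apply: (same_knowledge onA tG tH sG sH e0) => //; try exact: lene.
  move=> v u vis.
  (* With cap [N.+1] in [H], a node visited by [T] has level at most [m], so it is neither 0 nor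
     beyond [m.+1]. *)
  have lip u' w := @pot_lip R N (N.+1 + 3) _ _ N.+1 u' w (leqnn _) lvH.
  have := visited_potential lip exH.1 T0 vis.
  rewrite [pot _ _ _ 1]/pot /= min0n mul0r addr0 => /le_lt_trans/(_ Tm).
  rewrite ltr_pM2r // ltr_nat => lv; apply: (chord_edge_agree _ mN).
  by move: lv mN; clear; case: v => [|v] /=; lia.
(* Nonanticipation includes moves begun exactly at [T], so this departure also occurs in [G]. *)
have {}AT : (T, 0%N) \in A G 1%N i.
  have := onA.2 G H 1%N T tG tH sG sH know i => mv.
  have : (T, 0%N) \in [seq x <- A H 1%N i | x.1 <= T].
    by rewrite mem_filter AT /= lexx.
  by rewrite -mv mem_filter => /andP[].
exists G, 1%N; split=> //.
apply: (@ratio_ge _ _ _ (T + 1 + m.+1%:R / N.+1%:R)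
  (((m + 2)%:R / N.+1%:R) *+ 2)).
- by apply: (@opt_chord_gt0 _ _ _ _ _ _ m.+1) => //; exists (A G 1%N).
- exact: opt_chord_lo.
- apply: cost_ge => // t fin.
  have [t0 /(_ 0%N) vis _] := fin; move: vis; rewrite nodes_chord => /(_ isT) vis.
  (* Node 0 has potential above [T], so the exploration cannot finish by [T]. *)
  have lip u w := @pot_lip R N (m + 3) _ _ m.+1 u w mN lvG.
  have := visited_potential lip exG.1 t0 vis.
  rewrite [pot _ _ _ 1]/pot /= min0n mul0r addr0 => mt.
  apply: (crossing_cost mN lvG exG.1 fin AT); first exact: lt_le_trans mt.
  (* The other neighbour of 0, node [m + 2], has potential [m.+1 * e > T] and is still out of
     reach. *)
  move=> z /chord_edge_lo0[->//|->]; rewrite /pot -lvG => /le_lt_trans/(_ Tm).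
  by rewrite ltxx.
- by rewrite -/e; lra.
rewrite -/e natrD -[m.+1]addn1 natrD.
have xe : m%:R * e <= 1 - e.
  have : (m%:R + 1) * e <= N.+1%:R * e by rewrite ler_pM2r // natr1 ler_nat.
  by rewrite Ke mulrDl mul1r; lra.
have x0 : 0 <= m%:R * e by rewrite mulr_ge0 // ltW.
rewrite !mulrDl mul1r; move: (m%:R * e) mT xe x0 => x mT xe x0.
(* With [x = m e <= T] it suffices that [x (1 - 6 e) + 5 e - 12 e^2 <= 1]. As [6 e <= 1], the left
   side is nondecreasing in [x], and at [x = 1 - e] it is [1 - 2 e - 6 e^2]. *)
nra.
Qed.

Theorem theorem5 (R : realType) (k : nat) (A : strategy R k)
    (hk : (2 <= k)%N)
    (hA : online_exploration_strategy (@tadpole R) A) :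
  ((3 / 2 : R)%:E <= competitive_ratio (@tadpole R) A)%E.
Proof.
apply/lee_addgt0Pr => d d0.
(* The first summand makes the loss [3 / N.+1%:R] at most [d]; the [5] meets the size condition of
   [hard_instance]. *)
pose N := (Num.truncn (3 / d) + 5)%N.
have [|G [s [tG sG ratioG]]] := hard_instance hk hA (N := N).
  by rewrite leq_addl.
have N_d : 3 / N.+1%:R <= d.
  rewrite ler_pdivrMr ?ltr0n // mulrC -ler_pdivrMr //.
  apply: le_trans (ltW (truncnS_gt _)) _.
  by rewrite ler_nat ltnS leq_addr.
apply: (@le_trans _ _ ((cost G s (A G s) / opt G s k)%:E + d%:E)%E).
  rewrite -EFinD lee_fin -lerBlDr; apply: le_trans ratioG.
  by rewrite lerB.
by rewrite leeD2r //; apply: ereal_sup_ubound; exists G, s.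
Qed.
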